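(* Let $z_0 \in \mathbb{H}$. Then $$ \left\{g(z_0) \, : \, g \in \mathcal{H}_{\infty}(\mathbb{H}) \text{ univalent}\right\}=\left\{z \in \mathbb{C} \, : \, \operatorname{Im} z>\operatorname{Im} z_0\right\} \cup \{z_0\}.$$
   Context: $\mathbb{H}=\{z\in\mathbb{C}:\operatorname{Im} z>0\}$ is the upper half-plane. $\mathcal{H}_{\infty}(\mathbb{H})$ is the set of all holomorphic functions $g:\mathbb{H}\to\mathbb{H}$ satisfying the hydrodynamic normalization: for every $0<\beta<\pi/2$, $g(z)-z\to 0$ as $z\to\infty$ within the sector $S_\beta=\{z\in\mathbb{C}: |\arg z-\pi/2|<\beta\}$. ''Univalent'' means holomorphic and injective. *)

(* Defs.v *)
From Stdlib Require Import Reals Lra.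
From Coquelicot Require Import Coquelicot.

Open Scope R_scope.

(* A function on the open set [D] is represented by a total function [C -> C];
   only its values on [D] are ever constrained. *)

Definition upper_half_plane (z : C) : Prop := 0 < Im z.

Definition holomorphic_on (D : C -> Prop) (f : C -> C) : Prop :=
  forall z : C, D z -> @ex_derive C_AbsRing C_NormedModule f z.

Definition injective_on (D : C -> Prop) (f : C -> C) : Prop :=
  forall z w : C, D z -> D w -> f z = f w -> z = w.

Definition univalent_on (D : C -> Prop) (f : C -> C) : Prop :=
  holomorphic_on D f /\ injective_on D f.

(* Principal argument, with values in (-PI, PI]; meaningful for [z <> 0], see
   [Carg_spec]. *)
Definition Carg (z : C) : R :=
  if Rle_dec 0 (Im z) then acos (Re z / Cmod z) else - acos (Re z / Cmod z).

Definition sector (beta : R) (z : C) : Prop :=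
  z <> RtoC 0 /\ Rabs (Carg z - PI / 2) < beta.

(* Neighbourhoods of the point at infinity of the Riemann sphere. *)
Definition C_infinity (P : C -> Prop) : Prop :=
  exists M : R, forall z : C, M < Cmod z -> P z.

Definition hydrodynamic_normalization (g : C -> C) : Prop :=
  forall beta : R, 0 < beta < PI / 2 ->
    filterlim (fun z : C => (g z - z)%C)
      (within (sector beta) C_infinity)
      (@locally C_UniformSpace (RtoC 0)).

Definition H_infty (g : C -> C) : Prop :=
  holomorphic_on upper_half_plane g /\
  (forall z : C, upper_half_plane z -> upper_half_plane (g z)) /\
  hydrodynamic_normalization g.

Lemma Carg_spec (z : C) : z <> RtoC 0 ->
  - PI < Carg z <= PI /\
  z = (Cmod z * cos (Carg z), Cmod z * sin (Carg z)).
Proof.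
intros hz.
assert (hm : 0 < Cmod z) by (now apply Cmod_gt_0).
pose proof (Cmod2_alt z) as h2.
set (c := Re z / Cmod z).
assert (hc : -1 <= c <= 1).
{ pose proof (re_le_Cmod z) as h; apply Rabs_le_between in h; unfold c; split.
  - apply Rle_div_r; lra.
  - apply Rle_div_l; lra. }
assert (hre : Cmod z * c = Re z) by (unfold c; field; lra).
assert (hsin : Cmod z * sin (acos c) = Rabs (Im z)).
{ rewrite sin_acos by exact hc.
  rewrite <- (sqrt_Rsqr (Cmod z)) at 1 by lra.
  rewrite <- sqrt_mult_alt by apply Rle_0_sqr.
  rewrite <- sqrt_Rsqr_abs; f_equal.
  unfold Rsqr in *.
  replace (Cmod z * Cmod z * (1 - c * c))
    with (Cmod z * Cmod z - (Cmod z * c) * (Cmod z * c)) by ring.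
  rewrite hre; nra. }
pose proof (acos_bound c) as hb.
pose proof PI_RGT_0 as hpi.
unfold Carg; fold c; destruct (Rle_dec 0 (Im z)) as [hi | hi].
- split; [lra |].
  rewrite cos_acos by exact hc; rewrite hre, hsin, Rabs_pos_eq by exact hi.
  now destruct z.
- apply Rnot_le_lt in hi.
  assert (acos c <> PI).
  { intros e; rewrite e, sin_PI, Rmult_0_r in hsin.
    symmetry in hsin; apply Rabs_eq_0 in hsin; lra. }
  split; [lra |].
  rewrite cos_neg, sin_neg, cos_acos by exact hc.
  replace (Cmod z * - sin (acos c)) with (- (Cmod z * sin (acos c))) by ring.
  rewrite hre, hsin, Rabs_left by exact hi; rewrite Ropp_involutive.
  now destruct z.
Qed.

(* Main.v *)
(** For the inclusion from left to right, apply the Schwarz-Pick inequality to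
    [z0] and [z = z0 + i t] and let [t] tend to [+oo]: since [g z - z -> 0], it
    becomes [Im (g z0) >= Im z0], for every [z0].  In case of equality at [z0],
    [z |-> / (g z - z - a + i)] with [a = Re (g z0 - z0)] attains its maximum
    modulus at [z0], so [g z - z = a] along the vertical ray above [z0], and
    [a = 0] by the normalization.  Conversely, if [zeta = w - z0] has positive
    imaginary part, then [z |-> z - c / (z - a)] with [a = z0 + c / zeta] maps
    [z0] to [w], and for suitable [c > 0] the pole [a] is so far below the real
    axis, [c <= (Im a)^2], that the map is injective on the half-plane.

    The maximum principle comes from Goursat's theorem on rectangles, applied
    in logarithmic coordinates to yield the mean value property. *)

Require Import Defs.
From Stdlib Require Import Reals Lra Lia Classical ClassicalEpsilon.
From Coquelicot Require Import Coquelicot.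

(** * Goursat's theorem *)

(** Bisection: if [P] failed, some quarter would fail, and so on; the nested bad rectangles shrink
    to a point, where the local hypothesis contradicts their badness. It serves both Goursat's
    theorem and the extreme value theorem on rectangles. *)
Lemma rectangle_induction (P : R -> R -> R -> R -> Prop) (a b c d : R) :
  a <= b -> c <= d ->
  (forall a b c d, a <= b -> c <= d ->
    P a ((a + b) / 2) c ((c + d) / 2) -> P ((a + b) / 2) b c ((c + d) / 2) ->
    P a ((a + b) / 2) ((c + d) / 2) d -> P ((a + b) / 2) b ((c + d) / 2) d ->
    P a b c d) ->
  (forall x y, a <= x <= b -> c <= y <= d -> exists delta, 0 < delta /\
    forall a' b' c' d', a <= a' <= x -> x <= b' <= b -> c <= c' <= y ->
      y <= d' <= d -> b' - a' < delta -> d' - c' < delta -> P a' b' c' d') ->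
  P a b c d.
Proof.
intros hab hcd hquarter hlocal; apply NNPP; intros hbad.
set (w := fun n => (b - a) / 2 ^ n).
set (h := fun n => (d - c) / 2 ^ n).
assert (hw : forall n, w n = 2 * w (S n) /\ 0 <= w n).
{ intros n; unfold w; assert (0 < 2 ^ n) by (apply pow_lt; lra); split.
  - simpl; field; lra.
  - apply Rdiv_le_0_compat; lra. }
assert (hh : forall n, h n = 2 * h (S n) /\ 0 <= h n).
{ intros n; unfold h; assert (0 < 2 ^ n) by (apply pow_lt; lra); split.
  - simpl; field; lra.
  - apply Rdiv_le_0_compat; lra. }
(* A rectangle of generation [n] is recorded by its lower left corner alone, since its sides [w n]
   and [h n] are determined by [n]. *)
set (bad := fun n p => ~ P (fst p) (fst p + w n) (snd p) (snd p + h n)).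
assert (hstep : forall n (p : {p : R * R | bad n p}), exists q : {q | bad (S n) q},
  fst (proj1_sig p) <= fst (proj1_sig q) /\
  fst (proj1_sig q) + w (S n) <= fst (proj1_sig p) + w n /\
  snd (proj1_sig p) <= snd (proj1_sig q) /\
  snd (proj1_sig q) + h (S n) <= snd (proj1_sig p) + h n).
{ intros n [[x y] hp]; simpl.
  destruct (hw n) as [w1 w2]; destruct (hh n) as [h1 h2].
  assert (mx : (x + (x + w n)) / 2 = x + w (S n)) by lra.
  assert (my : (y + (y + h n)) / 2 = y + h (S n)) by lra.
  apply NNPP; intros hno; apply hp; simpl.
  apply hquarter; try lra; rewrite ?mx, ?my; apply NNPP; intros hb; apply hno.
  - exists (exist _ (x, y) hb); simpl; lra.
  - assert (hb' : bad (S n) (x + w (S n), y)).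
    { unfold bad; simpl; replace (x + w (S n) + w (S n)) with (x + w n) by lra; exact hb. }
    exists (exist _ _ hb'); simpl; lra.
  - assert (hb' : bad (S n) (x, y + h (S n))).
    { unfold bad; simpl; replace (y + h (S n) + h (S n)) with (y + h n) by lra; exact hb. }
    exists (exist _ _ hb'); simpl; lra.
  - assert (hb' : bad (S n) (x + w (S n), y + h (S n))).
    { unfold bad; simpl; replace (y + h (S n) + h (S n)) with (y + h n) by lra.
      replace (x + w (S n) + w (S n)) with (x + w n) by lra; exact hb. }
    exists (exist _ _ hb'); simpl; lra. }
assert (hbad0 : bad 0%nat (a, c)).
{ unfold bad, w, h; simpl.
  replace (a + (b - a) / 1) with b by field.
  replace (c + (d - c) / 1) with d by field; exact hbad. }
set (s := fix s n : {p | bad n p} :=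
  match n with
  | O => exist _ (a, c) hbad0
  | S m => proj1_sig (constructive_indefinite_description _ (hstep m (s m)))
  end).
set (X := fun n => fst (proj1_sig (s n))); set (Y := fun n => snd (proj1_sig (s n))).
assert (hs : forall n, X n <= X (S n) /\ X (S n) + w (S n) <= X n + w n /\
                       Y n <= Y (S n) /\ Y (S n) + h (S n) <= Y n + h n).
{ intros n; unfold X, Y; simpl.
  destruct (constructive_indefinite_description _ (hstep n (s n))) as [q hq]; exact hq. }
assert (hmono : forall n k, X n <= X (n + k)%nat /\ X (n + k)%nat + w (n + k)%nat <= X n + w n /\
                       Y n <= Y (n + k)%nat /\ Y (n + k)%nat + h (n + k)%nat <= Y n + h n).
{ intros n k; induction k as [| k IH].
  - rewrite Nat.add_0_r; lra.
  - rewrite Nat.add_succ_r; pose proof (hs (n + k)%nat); lra. }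
assert (hcross : forall n m, X m <= X n + w n /\ Y m <= Y n + h n).
{ intros n m; destruct (Nat.le_ge_cases n m) as [e | e].
  - replace m with (n + (m - n))%nat by lia; pose proof (hmono n (m - n)%nat).
    pose proof (hw (n + (m - n))%nat); pose proof (hh (n + (m - n))%nat); lra.
  - pose proof (hmono m (n - m)%nat) as hm; replace (m + (n - m))%nat with n in hm by lia.
    pose proof (hw n); pose proof (hh n); lra. }
assert (hlub : forall Z u, (forall n m, Z m <= Z n + u n) ->
  exists z, forall n : nat, Z n <= z <= Z n + u n).
{ intros Z u hZ; destruct (completeness (fun z => exists n : nat, z = Z n)) as [z [z1 z2]].
  - exists (Z O + u O); intros z [n ->]; apply hZ.
  - exists (Z O); now exists O.
  - exists z; intros n; split; [apply z1; now exists n |].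
    apply z2; intros t [m ->]; apply hZ. }
destruct (hlub X w) as [x hx]; [intros; apply hcross |].
destruct (hlub Y h) as [y hy]; [intros; apply hcross |].
assert (w0 : w O = b - a) by (unfold w; simpl; field).
assert (h0 : h O = d - c) by (unfold h; simpl; field).
assert (X0 : X O = a) by reflexivity; assert (Y0 : Y O = c) by reflexivity.
destruct (hlocal x y) as [delta [hdelta hP]].
{ pose proof (hx O); lra. }
{ pose proof (hy O); lra. }
(* The denominator exceeds both original sides, so [w N] and [h N] both fall below [delta]. *)
destruct (pow_lt_1_zero (/ 2)) with (y := delta / (b - a + (d - c) + 1)) as [N hN].
{ rewrite Rabs_pos_eq; lra. }
{ apply Rdiv_lt_0_compat; lra. }
specialize (hN N (le_n N)).
assert (h2 : 0 < (/ 2) ^ N) by (apply pow_lt; lra).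
rewrite Rabs_pos_eq in hN by lra.
apply Rlt_div_r in hN; [| lra].
assert (ew : w N = (b - a) * (/ 2) ^ N) by (unfold w; rewrite pow_inv; reflexivity).
assert (eh : h N = (d - c) * (/ 2) ^ N) by (unfold h; rewrite pow_inv; reflexivity).
apply (proj2_sig (s N)); fold (X N) (Y N).
pose proof (hx N); pose proof (hy N); pose proof (hmono O N) as hm; simpl in hm.
pose proof (hw N); pose proof (hh N).
apply hP; try lra; nra.
Qed.

Lemma RInt_near_const (v : R -> R) (a b k M : R) :
  a <= b -> (forall x, a <= x <= b -> continuous v x) ->
  (forall x, a <= x <= b -> Rabs (v x - k) <= M) ->
  Rabs (RInt v a b - (b - a) * k) <= (b - a) * M.
Proof.
intros hab hc hM.
assert (hv : ex_RInt v a b).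
{ apply (ex_RInt_continuous v); intros x; rewrite Rmin_left, Rmax_right by lra; apply hc. }
assert (hk : ex_RInt (fun _ : R => k) a b) by apply ex_RInt_const.
replace (RInt v a b - (b - a) * k) with (RInt (fun x => minus (v x) k) a b).
- apply abs_RInt_le_const; [exact hab | now apply (ex_RInt_minus (V := R_NormedModule)) | exact hM].
- rewrite (RInt_minus v (fun _ => k)) by assumption.
  rewrite RInt_const; reflexivity.
Qed.

(* [P dx + Q dy] is differentiable and closed at [(x, y)]: both cross partial
   derivatives equal [k]. *)
Definition closed_form_at (P Q : R -> R -> R) (x y : R) : Prop :=
  exists p k q, differentiable_pt_lim P x y p k /\ differentiable_pt_lim Q x y k q.

(* Oriented clockwise. *)
Definition boundary_integral (P Q : R -> R -> R) (a b c d : R) : R :=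
  RInt (fun x => P x d - P x c) a b - RInt (fun y => Q b y - Q a y) c d.

Lemma continuity_2d_pt_sections f x y : continuity_2d_pt f x y ->
  continuous (fun t => f t y) x /\ continuous (fun t => f x t) y.
Proof.
intros h; split; apply filterlim_locally; intros eps;
  destruct (h eps) as [delta hd]; exists delta; intros t ht; apply hd; trivial;
  rewrite Rminus_diag_eq, Rabs_R0 by reflexivity; apply cond_pos.
Qed.

Lemma closed_form_continuity P Q x y : closed_form_at P Q x y ->
  continuity_2d_pt P x y /\ continuity_2d_pt Q x y.
Proof.
intros [p [k [q [hP hQ]]]]; split; apply differentiable_continuity_pt; eexists; eexists; eassumption.
Qed.

(** Each inner side is traversed twice, in opposite directions. Closedness enters through
    continuity, which makes every piece integrable. *)
Lemma boundary_integral_quarter P Q a b c d : a <= b -> c <= d ->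
  (forall x y, a <= x <= b -> c <= y <= d -> closed_form_at P Q x y) ->
  boundary_integral P Q a b c d =
    boundary_integral P Q a ((a + b) / 2) c ((c + d) / 2) +
    boundary_integral P Q ((a + b) / 2) b c ((c + d) / 2) +
    boundary_integral P Q a ((a + b) / 2) ((c + d) / 2) d +
    boundary_integral P Q ((a + b) / 2) b ((c + d) / 2) d.
Proof.
intros hab hcd hform; unfold boundary_integral.
set (m := (a + b) / 2); set (n := (c + d) / 2).
assert (hm : a <= m <= b) by (unfold m; lra); assert (hn : c <= n <= d) by (unfold n; lra).
assert (hP : forall y a' b', c <= y <= d -> a <= a' -> a' <= b' -> b' <= b -> ex_RInt (fun x => P x y) a' b').
{ intros y a' b' hy h1 h2 h3; apply (ex_RInt_continuous (fun x => P x y)); intros x hx.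
  rewrite Rmin_left, Rmax_right in hx by lra.
  apply (continuity_2d_pt_sections P); apply (closed_form_continuity P Q); apply hform; lra. }
assert (hQ : forall x c' d', a <= x <= b -> c <= c' -> c' <= d' -> d' <= d -> ex_RInt (fun y => Q x y) c' d').
{ intros x c' d' hy h1 h2 h3; apply (ex_RInt_continuous (fun y => Q x y)); intros y hx.
  rewrite Rmin_left, Rmax_right in hx by lra.
  apply (continuity_2d_pt_sections Q); apply (closed_form_continuity P Q); apply hform; lra. }
assert (eP : forall a' b' y y', a <= a' -> a' <= b' -> b' <= b -> c <= y <= d -> c <= y' <= d ->
  RInt (fun x => P x y - P x y') a' b' = RInt (fun x => P x y) a' b' - RInt (fun x => P x y') a' b').
{ intros; apply (RInt_minus (fun x => P x y) (fun x => P x y')); apply hP; lra. }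
assert (eQ : forall c' d' x x', c <= c' -> c' <= d' -> d' <= d -> a <= x <= b -> a <= x' <= b ->
  RInt (fun y => Q x y - Q x' y) c' d' = RInt (fun y => Q x y) c' d' - RInt (fun y => Q x' y) c' d').
{ intros; apply (RInt_minus (fun y => Q x y) (fun y => Q x' y)); apply hQ; lra. }
rewrite !eP, !eQ by lra.
assert (cP : forall y, c <= y <= d -> RInt (fun x => P x y) a b = RInt (fun x => P x y) a m + RInt (fun x => P x y) m b).
{ intros; symmetry; apply (RInt_Chasles (fun x => P x y)); apply hP; lra. }
assert (cQ : forall x, a <= x <= b -> RInt (fun y => Q x y) c d = RInt (fun y => Q x y) c n + RInt (fun y => Q x y) n d).
{ intros; symmetry; apply (RInt_Chasles (fun y => Q x y)); apply hQ; lra. }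
rewrite !cP, !cQ by lra; ring.
Qed.

(** The affine part of the form at a point contributes nothing around a small rectangle, because the
    cross derivatives agree; the remainder is small compared with the squared size.
    [rectangle_induction] carries this bound to the whole rectangle. *)
Lemma goursat (P Q : R -> R -> R) (a b c d : R) : a <= b -> c <= d ->
  (forall x y, a <= x <= b -> c <= y <= d -> closed_form_at P Q x y) ->
  boundary_integral P Q a b c d = 0.
Proof.
intros hab hcd hform.
assert (hsmall : forall eps, 0 < eps ->
  Rabs (boundary_integral P Q a b c d) <= eps * ((b - a) ^ 2 + (d - c) ^ 2)).
{ intros eps heps.
  (* A quarter has a quarter of [w^2 + h^2], so this bound adds up. *)
  set (G := fun a' b' c' d' => a <= a' -> b' <= b -> c <= c' -> d' <= d ->
    Rabs (boundary_integral P Q a' b' c' d') <= eps * ((b' - a') ^ 2 + (d' - c') ^ 2)).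
  assert (hG : G a b c d); [| apply hG; lra].
  apply rectangle_induction; trivial; unfold G.
  - intros a' b' c' d' hab' hcd' h1 h2 h3 h4 ha hb hc hd.
    specialize (h1 ltac:(lra) ltac:(lra) ltac:(lra) ltac:(lra)).
    specialize (h2 ltac:(lra) ltac:(lra) ltac:(lra) ltac:(lra)).
    specialize (h3 ltac:(lra) ltac:(lra) ltac:(lra) ltac:(lra)).
    specialize (h4 ltac:(lra) ltac:(lra) ltac:(lra) ltac:(lra)).
    rewrite boundary_integral_quarter; trivial; [| intros; apply hform; lra].
    eapply Rle_trans; [apply Rabs_triang |].
    eapply Rle_trans; [apply Rplus_le_compat_r, Rabs_triang |].
    eapply Rle_trans; [apply Rplus_le_compat_r, Rplus_le_compat_r, Rabs_triang |].
    nra.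
  - intros x y hx hy.
    destruct (hform x y hx hy) as [p [k [q [hP hQ]]]].
    (* The difference across opposite sides doubles this to [eps / 4], and
       [s (w + h) <= 2 (w^2 + h^2)], with [w] and [h] the sides, doubles it once more. *)
    assert (he4 : 0 < eps / 8) by lra.
    destruct (hP (mkposreal _ he4)) as [d1 hd1]; destruct (hQ (mkposreal _ he4)) as [d2 hd2].
    exists (Rmin d1 d2); split; [apply Rmin_glb_lt; apply cond_pos |].
    intros a' b' c' d' ha' hb' hc' hd' hw hh _ _ _ _.
    set (s := Rmax (b' - a') (d' - c')).
    assert (hs : b' - a' <= s /\ d' - c' <= s) by (split; [apply Rmax_l | apply Rmax_r]).
    assert (hs2 : s < d1 /\ s < d2).
    { pose proof (Rmin_l d1 d2); pose proof (Rmin_r d1 d2); split; apply Rmax_lub_lt; lra. }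
    assert (hnear : forall u v, a' <= u <= b' -> c' <= v <= d' ->
      Rabs (u - x) <= s /\ Rabs (v - y) <= s) by (intros; split; apply Rabs_le; lra).
    assert (eP : forall u v, a' <= u <= b' -> c' <= v <= d' ->
      Rabs (P u v - P x y - (p * (u - x) + k * (v - y))) <= eps / 8 * s).
    { intros u v hu hv; destruct (hnear u v hu hv).
      eapply Rle_trans; [apply hd1; lra | simpl].
      apply Rmult_le_compat_l; [lra | apply Rmax_lub; lra]. }
    assert (eQ : forall u v, a' <= u <= b' -> c' <= v <= d' ->
      Rabs (Q u v - Q x y - (k * (u - x) + q * (v - y))) <= eps / 8 * s).
    { intros u v hu hv; destruct (hnear u v hu hv).
      eapply Rle_trans; [apply hd2; lra | simpl].
      apply Rmult_le_compat_l; [lra | apply Rmax_lub; lra]. }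
    assert (cf : forall u v, a' <= u <= b' -> c' <= v <= d' ->
      continuity_2d_pt P u v /\ continuity_2d_pt Q u v)
      by (intros; apply closed_form_continuity, hform; lra).
    (* Both integrals are compared with [k] times the area, which cancels in their difference. *)
    assert (I1 := RInt_near_const (fun t => P t d' - P t c') a' b' (k * (d' - c')) (eps / 4 * s)).
    assert (I2 := RInt_near_const (fun t => Q b' t - Q a' t) c' d' (k * (b' - a')) (eps / 4 * s)).
    unfold boundary_integral.
    assert (J1 := I1 ltac:(lra)); clear I1; assert (J2 := I2 ltac:(lra)); clear I2.
    assert (K1 : Rabs (RInt (fun t => P t d' - P t c') a' b' - (b' - a') * (k * (d' - c'))) <=
       (b' - a') * (eps / 4 * s)).
    { apply J1.
      - intros t ht; apply (continuous_minus (fun t => P t d') (fun t => P t c'));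
          apply (continuity_2d_pt_sections P), cf; lra.
      - intros t ht.
        assert (e1 := eP t d' ltac:(lra) ltac:(lra)); assert (e2 := eP t c' ltac:(lra) ltac:(lra)).
        apply Rabs_le_between in e1; apply Rabs_le_between in e2; apply Rabs_le; lra. }
    assert (K2 : Rabs (RInt (fun t => Q b' t - Q a' t) c' d' - (d' - c') * (k * (b' - a'))) <=
       (d' - c') * (eps / 4 * s)).
    { apply J2.
      - intros t ht; apply (continuous_minus (fun t => Q b' t) (fun t => Q a' t));
          apply (continuity_2d_pt_sections Q), cf; lra.
      - intros t ht.
        assert (e1 := eQ b' t ltac:(lra) ltac:(lra)); assert (e2 := eQ a' t ltac:(lra) ltac:(lra)).
        apply Rabs_le_between in e1; apply Rabs_le_between in e2; apply Rabs_le; lra. }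
    apply Rabs_le_between in K1; apply Rabs_le_between in K2.
    assert (hss : s * (b' - a') + s * (d' - c') <= 2 * ((b' - a') ^ 2 + (d' - c') ^ 2)).
    { unfold s, Rmax; destruct Rle_dec; nra. }
    apply Rle_trans with (eps / 4 * (s * (b' - a') + s * (d' - c'))).
    + apply Rabs_le; lra.
    + nra. }
apply Rabs_eq_0, Rle_antisym; [| apply Rabs_pos].
apply Rnot_lt_le; intros hpos.
set (A := (b - a) ^ 2 + (d - c) ^ 2) in *; assert (0 <= A) by (unfold A; nra).
(* For this [eps] the bound is strictly less than the absolute value of the integral itself, unless
   that is zero. *)
specialize (hsmall (Rabs (boundary_integral P Q a b c d) / (2 * (A + 1)))).
assert (e : Rabs (boundary_integral P Q a b c d) / (2 * (A + 1)) * A <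
          Rabs (boundary_integral P Q a b c d)).
{ unfold Rdiv; rewrite Rmult_assoc; rewrite <- (Rmult_1_r (Rabs _)) at 2.
  apply Rmult_lt_compat_l; trivial.
  rewrite Rmult_comm; apply Rlt_div_l; lra. }
assert (0 < Rabs (boundary_integral P Q a b c d) / (2 * (A + 1))) by (apply Rdiv_lt_0_compat; lra).
specialize (hsmall H0); lra.
Qed.

(** * The mean value property *)

Notation is_cderive f z l := (@is_derive C_AbsRing C_NormedModule f z l).
Notation ex_cderive f z := (@ex_derive C_AbsRing C_NormedModule f z).
Notation ccontinuous f z :=
  (@continuous (AbsRing_UniformSpace C_AbsRing) (NormedModule.UniformSpace C_AbsRing C_NormedModule) f z).

Lemma is_cderive_eps (f : C -> C) (z l : C) :
  is_cderive f z l <->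
  forall eps, 0 < eps -> exists delta, 0 < delta /\ forall w : C, Cmod (w - z) < delta ->
    Cmod (f w - f z - (w - z) * l) <= eps * Cmod (w - z).
Proof.
split.
- intros [_ h] eps heps.
  destruct (h z (fun P hP => hP) (mkposreal _ heps)) as [delta hd].
  exists delta; split; [apply cond_pos |]; intros w hw; exact (hd w hw).
- intros h; split; [apply (is_linear_scal_l (K := C_AbsRing) (V := C_NormedModule)) |].
  intros x hx.
  assert (e := is_filter_lim_locally_unique (K := C_AbsRing) (V := AbsRing_NormedModule C_AbsRing) _ _ hx).
  rewrite <- e; clear x hx e.
  intros eps; destruct (h eps (cond_pos eps)) as [delta [h1 h2]].
  exists (mkposreal _ h1); intros w hw; exact (h2 w hw).
Qed.

(** In [ccontinuous] the balls are discs in the source and squares in the target, hence the detour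
    through [locally_norm]. *)
Lemma ccontinuous_eps (f : C -> C) (z : C) :
  ccontinuous f z <->
  forall eps, 0 < eps -> exists delta, 0 < delta /\ forall w : C, Cmod (w - z) < delta ->
    Cmod (f w - f z) < eps.
Proof.
split.
- intros h eps heps.
  destruct (h (fun y => @ball_norm _ C_NormedModule (f z) eps y)) as [delta hd].
  { apply (locally_le_locally_norm (V := C_NormedModule)).
    exists (mkposreal _ heps); intros y hy; exact hy. }
  exists delta; split; [apply cond_pos |]; intros w hw; exact (hd w hw).
- intros h P hP.
  apply (locally_norm_le_locally (V := C_NormedModule)) in hP; destruct hP as [eps hP].
  destruct (h eps (cond_pos eps)) as [delta [h1 h2]].
  exists (mkposreal _ h1); intros w hw; apply hP; exact (h2 w hw).
Qed.

Lemma Cmod_Re_Im_le (z : C) : Rabs (Re z) <= Cmod z /\ Rabs (Im z) <= Cmod z.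
Proof.
pose proof (Rmax_Cmod z); pose proof (Rmax_l (Rabs (fst z)) (Rabs (snd z)));
pose proof (Rmax_r (Rabs (fst z)) (Rabs (snd z))); unfold Re, Im; lra.
Qed.

Lemma Cmod_le_Rmax (z : C) : Cmod z <= 2 * Rmax (Rabs (Re z)) (Rabs (Im z)).
Proof.
eapply Rle_trans; [apply Cmod_2Rmax |].
apply Rmult_le_compat_r.
- eapply Rle_trans; [apply Rabs_pos | apply Rmax_l].
- apply Rlt_le, sqrt_less_alt; lra.
Qed.

Lemma cauchy_riemann (f : C -> C) (x y : R) (l : C) : is_cderive f (x, y) l ->
  differentiable_pt_lim (fun u v => Re (f (u, v))) x y (Re l) (- Im l) /\
  differentiable_pt_lim (fun u v => Im (f (u, v))) x y (Im l) (Re l).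
Proof.
intros h; rewrite is_cderive_eps in h.
assert (h' : forall eps : posreal, exists delta : posreal, forall u v,
  Rabs (u - x) < delta -> Rabs (v - y) < delta ->
  Cmod (f (u, v) - f (x, y) - ((u, v) - (x, y)) * l) <= eps * Rmax (Rabs (u - x)) (Rabs (v - y))).
(* [Cmod] is at most twice the maximum norm, in which [differentiable_pt_lim] is stated; hence the
   halves. *)
{ intros eps; assert (he : 0 < eps / 2) by (pose proof (cond_pos eps); lra); destruct (h (eps / 2) he) as [delta [h1 h2]].
  assert (h3 : 0 < delta / 2) by lra; exists (mkposreal _ h3); simpl; intros u v hu hv.
  pose proof (Cmod_le_Rmax ((u, v) - (x, y))) as hm; simpl in hm.
  change (u + - x) with (u - x) in hm; change (v + - y) with (v - y) in hm.
  eapply Rle_trans; [apply h2 |].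
  - eapply Rle_lt_trans; [apply hm |].
    assert (Rmax (Rabs (u - x)) (Rabs (v - y)) < delta / 2) by (now apply Rmax_lub_lt); lra.
  - pose proof (cond_pos eps); nra. }
split; intros eps; destruct (h' eps) as [delta hd]; exists delta; intros u v hu hv;
  (eapply Rle_trans; [| apply (hd u v hu hv)]).
- eapply Rle_trans; [| apply (proj1 (Cmod_Re_Im_le _))].
  right; f_equal; unfold Re, Im; simpl; ring.
- eapply Rle_trans; [| apply (proj2 (Cmod_Re_Im_le _))].
  right; f_equal; unfold Re, Im; simpl; ring.
Qed.

Definition polar (p : C) (r t : R) : C := (Re p + r * cos t, Im p + r * sin t).

Lemma Cmod_polar p r t : Cmod (polar p r t - p) = Rabs r.
Proof.
unfold Cmod, polar; simpl; rewrite <- sqrt_Rsqr_abs; f_equal.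
pose proof (sin2_cos2 t); unfold Rsqr, Re, Im in *; nra.
Qed.

(** Under [z = p + exp (s + i t)] the form [f dz / (z - p)] becomes [f (ds + i dt)]; its imaginary
    part is [Im f ds + Re f dt], the form considered here. The Cauchy-Riemann equations make the
    cross derivatives equal. *)
Lemma log_polar_closed_form (f : C -> C) (p : C) (s t : R) : ex_cderive f (polar p (exp s) t) ->
  closed_form_at (fun s t => Im (f (polar p (exp s) t))) (fun s t => Re (f (polar p (exp s) t))) s t.
Proof.
intros [l hl]; apply cauchy_riemann in hl; destruct hl as [hre him].
(* The common shape of both coordinates of [polar p (exp s) t], with [h] the cosine or the sine. *)
assert (hprod : forall c (h dh : R -> R), (forall t, is_derive h t (dh t)) ->
  differentiable_pt_lim (fun s t => c + exp s * h t) s t (exp s * h t) (exp s * dh t)).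
{ intros c h dh hh; apply filterdiff_differentiable_pt_lim.
  apply (is_derive_filterdiff (fun s t => c + exp s * h t) s t (fun s t => exp s * h t)).
  - apply filter_forall; intros u; auto_derive; trivial; ring.
  - specialize (hh t); auto_derive; [now exists (dh t) |].
    rewrite (is_derive_unique (fun x : R => h x) t (dh t) hh : Derive (fun x : R => h x) t = _); ring.
  - apply (continuous_mult (fun u : R * R => exp (fst u)) (fun u : R * R => h (snd u))).
    + apply (continuous_comp fst exp); [apply continuous_fst |].
      apply (ex_derive_continuous exp); auto_derive; trivial.
    + apply (continuous_comp snd h); [apply continuous_snd |].
      apply (ex_derive_continuous h); eexists; apply hh. }
assert (hx := hprod (Re p) cos (fun t => - sin t) is_derive_cos).
assert (hy := hprod (Im p) sin cos is_derive_sin).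
exists (Im l * (exp s * cos t) + Re l * (exp s * sin t)),
  (Im l * (exp s * - sin t) + Re l * (exp s * cos t)),
  (Re l * (exp s * - sin t) + - Im l * (exp s * cos t)).
split.
- apply (differentiable_pt_lim_comp _ _ _ _ _ _ _ _ _ _ _ him hx hy).
- replace (Im l * (exp s * - sin t) + Re l * (exp s * cos t)) with
    (Re l * (exp s * cos t) + - Im l * (exp s * sin t)) by ring.
  apply (differentiable_pt_lim_comp _ _ _ _ _ _ _ _ _ _ _ hre hx hy).
Qed.

(* In the coordinates [w = s + i t] of [z = p + exp w] the circle means are
   independent of [s], by Goursat's theorem on [s0, s1] x [0, 2 PI], whose two
   horizontal sides cancel; then let [s] tend to [-oo]. *)
Lemma mean_value_Re (f : C -> C) (p : C) (r0 : R) :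
  (forall z, 0 < Cmod (z - p) < r0 -> ex_cderive f z) -> ccontinuous f p ->
  forall r, 0 < r < r0 ->
  (forall t, continuous (fun t => Re (f (polar p r t))) t) /\
  RInt (fun t => Re (f (polar p r t))) 0 (2 * PI) = 2 * PI * Re (f p).
Proof.
intros hf hp r hr.
pose proof PI_RGT_0 as hpi.
assert (hform : forall s t, exp s < r0 -> closed_form_at
  (fun s t => Im (f (polar p (exp s) t))) (fun s t => Re (f (polar p (exp s) t))) s t).
{ intros s t hs; apply log_polar_closed_form, hf.
  rewrite Cmod_polar, Rabs_pos_eq; pose proof (exp_pos s); lra. }
assert (hcont : forall s t, exp s < r0 -> continuous (fun t => Re (f (polar p (exp s) t))) t).
{ intros s t hs.
  apply (continuity_2d_pt_sections (fun s t => Re (f (polar p (exp s) t)))).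
  apply (closed_form_continuity _ _ _ _ (hform s t hs)). }
set (M := fun s => RInt (fun t => Re (f (polar p (exp s) t))) 0 (2 * PI)).
assert (hexp : forall s, s <= ln r -> exp s < r0).
{ intros s hs; apply Rle_lt_trans with r; [| apply hr].
  rewrite <- (exp_ln r) by lra; destruct hs as [hs | ->]; [apply Rlt_le, exp_increasing, hs | lra]. }
assert (hM : forall s, s <= ln r -> M (ln r) = M s).
{ intros s hs.
  assert (e := goursat _ _ s (ln r) 0 (2 * PI) hs ltac:(lra)
    (fun x y hx _ => hform x y (hexp x (proj2 hx)))).
  unfold boundary_integral in e.
  rewrite (RInt_ext _ (fun _ => 0)) in e.
  2: { intros x _; unfold polar; rewrite cos_2PI, sin_2PI, cos_0, sin_0; apply Rminus_diag_eq; reflexivity. }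
  rewrite RInt_const in e.
  assert (hex : forall s', s' <= ln r -> ex_RInt (fun t => Re (f (polar p (exp s') t))) 0 (2 * PI)).
  { intros s' hs'; apply (ex_RInt_continuous (fun t => Re (f (polar p (exp s') t)))).
    intros t _; now apply hcont, hexp. }
  assert (e2 := RInt_minus _ _ _ _ (hex (ln r) ltac:(lra)) (hex s hs)).
  unfold scal in e; simpl in e; unfold mult in e; simpl in e.
  unfold minus, plus, opp in e2; simpl in e2.
  change (RInt (fun x => Re (f (polar p (exp (ln r)) x)) + - Re (f (polar p (exp s) x))) 0 (2 * PI)
    = M (ln r) + - M s) in e2.
  unfold Rminus in e; rewrite e2 in e; lra. }
split.
- intros t; rewrite <- (exp_ln r) by lra; apply hcont; rewrite exp_ln; lra.
- rewrite <- (exp_ln r) by lra; change (M (ln r) = 2 * PI * Re (f p)).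
  apply Rminus_diag_uniq, Rabs_eq_0, Rle_antisym; [| apply Rabs_pos].
  apply le_epsilon; intros eps heps; rewrite Rplus_0_l.
  assert (he : 0 < eps / (2 * PI)) by (apply Rdiv_lt_0_compat; lra).
  destruct (proj1 (ccontinuous_eps f p) hp _ he) as [delta [hd1 hd2]].
  (* Small enough for continuity at [p], and at most [r], so that [hM] moves the mean from radius
     [r] to radius [rho]. *)
  set (rho := Rmin r (delta / 2)).
  assert (hrho : 0 < rho) by (apply Rmin_glb_lt; lra).
  assert (hrho2 : rho <= r) by apply Rmin_l; assert (hrho3 : rho <= delta / 2) by apply Rmin_r.
  rewrite (hM (ln rho)) by (apply ln_le; lra); unfold M.
  assert (hn := RInt_near_const (fun t => Re (f (polar p (exp (ln rho)) t))) 0 (2 * PI)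
    (Re (f p)) (eps / (2 * PI)) ltac:(lra)).
  rewrite Rminus_0_r in hn.
  replace (2 * PI * (eps / (2 * PI))) with eps in hn by (field; lra).
  apply hn.
  + intros t _; apply hcont; rewrite exp_ln; lra.
  + intros t _; rewrite exp_ln by lra.
    assert (hc := hd2 (polar p rho t)).
    rewrite Cmod_polar, Rabs_pos_eq in hc by lra.
    specialize (hc ltac:(lra)).
    pose proof (proj1 (Cmod_Re_Im_le (f (polar p rho t) - f p))) as hre.
    unfold Re in *; simpl in hre; unfold Rminus; lra.
Qed.

(** [M - v] is continuous, nonnegative and has integral zero; if it were positive at [t], a small
    interval around [t] would make the integral positive. *)
Lemma RInt_eq_max (v : R -> R) (a b M : R) :
  (forall t, continuous v t) -> (forall t, v t <= M) -> RInt v a b = (b - a) * M ->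
  forall t, a < t < b -> v t = M.
Proof.
intros hc hM hint t ht.
apply Rle_antisym; [apply hM | apply Rnot_lt_le; intros hlt].
assert (hcw : forall x, continuous (fun x => M - v x) x).
{ intros x; apply (continuous_minus (fun _ => M) v); [apply continuous_const | apply hc]. }
assert (hex : forall a' b', ex_RInt (fun x => M - v x) a' b').
{ intros a' b'; apply (ex_RInt_continuous (fun x => M - v x)); intros; apply hcw. }
assert (e0 : 0 < M - v t) by lra.
destruct (proj1 (filterlim_locally v (v t)) (hc t) (mkposreal _ e0)) as [delta hd].
set (s := Rmin (delta / 2) (Rmin (t - a) (b - t) / 2)).
assert (hdp := cond_pos delta).
assert (hs0 : 0 < s).
{ apply Rmin_glb_lt; [lra |]; assert (0 < Rmin (t - a) (b - t)) by (apply Rmin_glb_lt; lra); lra. }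
assert (hs1 : s <= delta / 2) by apply Rmin_l.
assert (hs2 : s <= Rmin (t - a) (b - t) / 2) by apply Rmin_r.
pose proof (Rmin_l (t - a) (b - t)); pose proof (Rmin_r (t - a) (b - t)).
assert (I2 : 0 < RInt (fun x => M - v x) (t - s) (t + s)).
{ apply RInt_gt_0; [lra | | intros; apply hcw].
  intros x hx; assert (hb := hd x ltac:(apply Rabs_lt_between; unfold minus, plus, opp; simpl; lra)).
  apply Rabs_lt_between in hb; unfold minus, plus, opp in hb; simpl in hb; lra. }
assert (I1 : 0 <= RInt (fun x => M - v x) a (t - s))
  by (apply RInt_ge_0; [lra | apply hex | intros x _; specialize (hM x); lra]).
assert (I3 : 0 <= RInt (fun x => M - v x) (t + s) b)
  by (apply RInt_ge_0; [lra | apply hex | intros x _; specialize (hM x); lra]).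
assert (c1 := RInt_Chasles _ a (t - s) b (hex _ _) (hex _ _)).
assert (c2 := RInt_Chasles _ (t - s) (t + s) b (hex _ _) (hex _ _)).
unfold plus in c1, c2; simpl in c1, c2.
assert (e := RInt_minus (fun _ => M) v a b (ex_RInt_const _ _ _)
  (ex_RInt_continuous v a b (fun x _ => hc x))).
rewrite RInt_const, hint in e; unfold scal in e; simpl in e; unfold mult in e; simpl in e.
unfold minus, plus, opp in e; simpl in e.
change (RInt (fun x => M - v x) a b = (b - a) * M + - ((b - a) * M)) in e.
lra.
Qed.

(** * The maximum principle *)

(* [C_NormedModule] and [C_AbsRing] seen as a module over itself have the same
   norm but different uniform structures; the library states the product and
   chain rules for the latter. *)
Lemma is_cderive_ring (f : C -> C) (z l : C) :
  is_cderive f z l <-> @is_derive C_AbsRing (AbsRing_NormedModule C_AbsRing) f z l.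
Proof. split; intros [[h1 h2 h3] h]; (split; [split; [exact h1 | exact h2 | exact h3] | exact h]). Qed.

Lemma ex_cderive_mult (f g : C -> C) (z : C) :
  ex_cderive f z -> ex_cderive g z -> ex_cderive (fun w => (f w * g w)%C) z.
Proof.
intros [l hf] [m hg]; eexists; apply is_cderive_ring.
apply is_cderive_ring in hf; apply is_cderive_ring in hg.
exact (is_derive_mult (K := C_AbsRing) f g z l m hf hg Cmult_comm).
Qed.

Lemma ex_cderive_minus (f g : C -> C) (z : C) :
  ex_cderive f z -> ex_cderive g z -> ex_cderive (fun w => (f w - g w)%C) z.
Proof. exact (ex_derive_minus (K := C_AbsRing) (V := C_NormedModule) f g z). Qed.

Lemma ex_cderive_const (c z : C) : ex_cderive (fun _ => c) z.
Proof. exact (ex_derive_const (K := C_AbsRing) (V := C_NormedModule) c z). Qed.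

Lemma ex_cderive_id (z : C) : ex_cderive (fun w => w) z.
Proof. eexists; apply is_cderive_ring, (is_derive_id (K := C_AbsRing)). Qed.

Lemma Cmod_minus_sym (z w : C) : Cmod (z - w) = Cmod (w - z).
Proof. rewrite <- Cmod_opp; f_equal; ring. Qed.

Lemma ex_cderive_Cinv (z : C) : z <> 0 -> ex_cderive Cinv z.
Proof.
intros hz; exists (- / (z * z))%C; apply is_cderive_eps; intros eps heps.
assert (hz0 : 0 < Cmod z) by now apply Cmod_gt_0.
set (m := Cmod z) in *.
assert (0 < m ^ 3) by (apply pow_lt; lra).
(* The first bound keeps [Cmod w > m / 2]; the second then controls the remainder
   [(w - z)^2 / (w z^2)]. *)
exists (Rmin (m / 2) (eps * m ^ 3 / 2)); split; [apply Rmin_glb_lt; nra |].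
intros w hw.
assert (h1 : Cmod (w - z) < m / 2) by (eapply Rlt_le_trans; [apply hw | apply Rmin_l]).
assert (h2 : Cmod (w - z) < eps * m ^ 3 / 2) by (eapply Rlt_le_trans; [apply hw | apply Rmin_r]).
assert (h3 : m / 2 < Cmod w).
{ pose proof (Cmod_triangle (z - w) w) as h; replace (z - w + w)%C with z in h by ring.
  rewrite Cmod_minus_sym in h; fold m in h; lra. }
assert (hw0 : w <> 0) by (apply Cmod_gt_0; lra).
replace (/ w - / z - (w - z) * - / (z * z))%C with ((w - z) * ((w - z) * (/ w * / (z * z))))%C
  by (field; auto).
rewrite !Cmod_mult, !Cmod_inv, Cmod_mult by (trivial; now apply Cmult_neq_0).
fold m; rewrite Rmult_comm; apply Rmult_le_compat_r; [apply Cmod_ge_0 |].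
rewrite <- Rinv_mult; change (Cmod (w - z) / (Cmod w * (m * m)) <= eps).
apply Rle_div_l; [nra |].
apply Rle_trans with (eps * (m / 2 * (m * m))); [nra |].
apply Rmult_le_compat_l; [lra |]; apply Rmult_le_compat_r; nra.
Qed.

Lemma ex_cderive_inv (f : C -> C) (z : C) :
  f z <> 0 -> ex_cderive f z -> ex_cderive (fun w => (/ f w)%C) z.
Proof.
intros hz [l hf]; destruct (ex_cderive_Cinv (f z) hz) as [m hm]; eexists.
apply is_cderive_ring in hf.
exact (is_derive_comp (K := C_AbsRing) (V := C_NormedModule) Cinv f z m l hm hf).
Qed.

Lemma ccontinuous_mult (f g : C -> C) (z : C) :
  ccontinuous f z -> ccontinuous g z -> ccontinuous (fun w => (f w * g w)%C) z.
Proof.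
intros hf hg; rewrite ccontinuous_eps in hf, hg |- *; intros eps heps.
set (A := Cmod (f z)); set (B := Cmod (g z)).
assert (hA : 0 <= A) by apply Cmod_ge_0; assert (hB : 0 <= B) by apply Cmod_ge_0.
set (e := Rmin 1 (eps / (A + B + 2))).
assert (he : 0 < e) by (apply Rmin_glb_lt; [lra | apply Rdiv_lt_0_compat; lra]).
assert (he1 : e <= 1) by apply Rmin_l.
assert (he2 : e * (A + B + 2) <= eps) by (apply Rle_div_r; [lra | apply Rmin_r]).
destruct (hf e he) as [d1 [p1 h1]]; destruct (hg e he) as [d2 [p2 h2]].
exists (Rmin d1 d2); split; [now apply Rmin_glb_lt |]; intros w hw.
specialize (h1 w (Rlt_le_trans _ _ _ hw (Rmin_l _ _))).
specialize (h2 w (Rlt_le_trans _ _ _ hw (Rmin_r _ _))).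
replace (f w * g w - f z * g z)%C with
  ((f w - f z) * (g w - g z) + (f w - f z) * g z + f z * (g w - g z))%C by ring.
eapply Rle_lt_trans; [apply Cmod_triangle |].
eapply Rle_lt_trans; [apply Rplus_le_compat_r, Cmod_triangle |].
rewrite !Cmod_mult; fold A B.
pose proof (Cmod_ge_0 (f w - f z)); pose proof (Cmod_ge_0 (g w - g z)); nra.
Qed.

Lemma ex_cderive_continuous (f : C -> C) (z : C) : ex_cderive f z -> ccontinuous f z.
Proof. exact (ex_derive_continuous (K := C_AbsRing) (V := C_NormedModule) f z). Qed.

(** After multiplication by [Cconj (F q)], the real part at [q] is [|F q|^2], an upper bound for it
    on every small circle around [q]; the mean value property forces equality on the circle. The
    punctured disc allows for a removable singularity at the centre. The top of the circle suffices
    for climbing a vertical ray. *)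
Lemma maximum_principle_local (F : C -> C) (q : C) (r0 : R) :
  (forall z, 0 < Cmod (z - q) < r0 -> ex_cderive F z) -> ccontinuous F q ->
  (forall z, Cmod (z - q) < r0 -> Cmod (F z) <= Cmod (F q)) ->
  forall r, 0 < r < r0 -> F (Re q, Im q + r) = F q.
Proof.
intros hd hc hmax r hr; pose proof PI_RGT_0 as hpi.
set (f := fun z => (Cconj (F q) * F z)%C).
destruct (mean_value_Re f q r0) with (r := r) as [hcont hmean]; trivial.
{ intros z hz; apply ex_cderive_mult; [apply ex_cderive_const | now apply hd]. }
{ apply ccontinuous_mult; [apply ex_cderive_continuous, ex_cderive_const | exact hc]. }
assert (efq : Re (f q) = Cmod (F q) ^ 2).
{ unfold f; rewrite Cmod2_alt; unfold Re, Im, Cconj; simpl; ring. }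
assert (hq : polar q r (PI / 2) = (Re q, Im q + r)).
{ unfold polar; rewrite cos_PI2, sin_PI2; f_equal; ring. }
assert (hle : forall t, Cmod (F (polar q r t)) <= Cmod (F q)).
{ intros t; apply hmax; rewrite Cmod_polar, Rabs_pos_eq; lra. }
assert (e : Re (f (polar q r (PI / 2))) = Cmod (F q) ^ 2).
{ apply (RInt_eq_max (fun t => Re (f (polar q r t))) 0 (2 * PI)).
  - exact hcont.
  - intros t; eapply Rle_trans; [apply Rle_abs |].
    eapply Rle_trans; [apply (proj1 (Cmod_Re_Im_le _)) |].
    unfold f; rewrite Cmod_mult, Cmod_conj.
    pose proof (hle t); pose proof (Cmod_ge_0 (F q)); nra.
  - rewrite Rminus_0_r, <- efq; exact hmean.
  - lra. }
specialize (hle (PI / 2)); rewrite hq in *.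
(* |F z - F q|^2 = |F z|^2 + |F q|^2 - 2 Re (conj (F q) F z) <= 0 *)
set (z := (Re q, Im q + r)) in *.
assert (hz : Cmod (F z) ^ 2 <= Cmod (F q) ^ 2) by (apply pow_incr; pose proof (Cmod_ge_0 (F z)); lra).
assert (h0 : Cmod (F z - F q) = 0).
{ assert (e2 : Cmod (F z - F q) ^ 2 = Cmod (F z) ^ 2 + Cmod (F q) ^ 2 - 2 * Re (f z)).
  { unfold f; rewrite !Cmod2_alt; unfold Re, Im, Cconj; simpl; ring. }
  pose proof (Cmod_ge_0 (F z - F q)); nra. }
apply Cmod_eq_0 in h0; replace (F z) with (F z - F q + F q)%C by ring; rewrite h0; ring.
Qed.

(** A continuation argument: at the supremum [T] of the heights up to which [F] is constant, the
    value persists by continuity, and the local principle there pushes beyond [T]. *)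
Lemma maximum_principle_ray (F : C -> C) (p : C) : upper_half_plane p ->
  (forall z, upper_half_plane z -> ccontinuous F z) ->
  (forall z, upper_half_plane z -> exists r0, 0 < r0 /\
    forall w, 0 < Cmod (w - z) < r0 -> ex_cderive F w) ->
  (forall z, upper_half_plane z -> Cmod (F z) <= Cmod (F p)) ->
  forall t, 0 <= t -> F (Re p, Im p + t) = F p.
Proof.
intros hp hc hd hmax t ht; unfold upper_half_plane in *.
set (E := fun s => 0 <= s <= t /\ forall u, 0 <= u <= s -> F (Re p, Im p + u) = F p).
assert (hE0 : E 0).
{ split; [lra |]; intros u hu; replace u with 0 by lra; rewrite Rplus_0_r; now destruct p. }
destruct (completeness E) as [T [hT1 hT2]].
{ exists t; intros s [hs _]; lra. }
{ now exists 0. }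
assert (hT : 0 <= T <= t) by (split; [now apply hT1 | apply hT2; intros s [hs _]; lra]).
assert (hlt : forall u, 0 <= u < T -> F (Re p, Im p + u) = F p).
{ intros u hu; apply NNPP; intros hn.
  assert (T <= u); [| lra].
  apply hT2; intros s [hs1 hs2]; apply Rnot_lt_le; intros h; apply hn, hs2; lra. }
set (q := (Re p, Im p + T)).
assert (hq : 0 < Im q) by (simpl; unfold Im in *; lra).
assert (hFq : F q = F p).
{ assert (hz : Cmod (F q - F p) = 0).
  { apply Rle_antisym; [| apply Cmod_ge_0].
    apply le_epsilon; intros eps heps; rewrite Rplus_0_l.
    destruct (proj1 (ccontinuous_eps F q) (hc q hq) eps heps) as [delta [hdelta h]].
    destruct (Req_dec T 0) as [e | e].
    { unfold q; rewrite e, Rplus_0_r, <- (proj2 hE0 0), Rplus_0_r by lra.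
      replace (F (Re p, Im p) - F (Re p, Im p))%C with (RtoC 0) by ring; rewrite Cmod_0; lra. }
    set (u := Rmax 0 (T - delta / 2)).
    assert (hu1 : 0 <= u) by apply Rmax_l; assert (hu2 : T - delta / 2 <= u) by apply Rmax_r.
    assert (hu3 : u < T) by (apply Rmax_lub_lt; lra).
    rewrite Cmod_minus_sym, <- (hlt u) by lra; apply Rlt_le, h.
    replace ((Re p, (Im p + u)%R) - q)%C with (RtoC (u - T) * Ci)%C
      by (unfold q; apply injective_projections; simpl; ring).
    rewrite Cmod_mult, Cmod_Ci, Cmod_R; rewrite Rmult_1_r; apply Rabs_lt_between; lra. }
  apply Cmod_eq_0 in hz; replace (F q) with (F q - F p + F p)%C by ring; rewrite hz; ring. }
destruct (hd q hq) as [r1 [hr1 hd1]].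
(* The disc has to stay inside the half-plane, where [hmax] is available. *)
set (r0 := Rmin r1 (Im q)).
assert (hr0 : 0 < r0) by now apply Rmin_glb_lt.
assert (hloc := maximum_principle_local F q r0).
assert (hray : forall r, 0 < r < r0 -> F (Re p, Im p + (T + r)) = F p).
{ intros r hr; rewrite <- hFq, <- Rplus_assoc; apply hloc; trivial.
  - intros z hz; apply hd1; split; [lra |]; eapply Rlt_le_trans; [apply hz | apply Rmin_l].
  - now apply hc.
  - intros z hz; rewrite hFq; apply hmax.
    assert (h : Cmod (z - q) < Im q) by (eapply Rlt_le_trans; [apply hz | apply Rmin_r]).
    pose proof (proj2 (Cmod_Re_Im_le (z - q))) as h2.
    assert (h3 := Rle_lt_trans _ _ _ h2 h); apply Rabs_lt_between in h3.
    unfold Im in *; simpl in h3; lra. }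
assert (hu : forall u, 0 <= u -> u < T + r0 -> F (Re p, Im p + u) = F p).
{ intros u h1 h2; destruct (Rtotal_order u T) as [h | [-> | h]]; [now apply hlt | exact hFq |].
  replace u with (T + (u - T)) by ring; apply hray; lra. }
apply hu; trivial; apply Rnot_le_lt; intros h.
assert (hE : E (T + r0 / 2)) by (split; [lra | intros; apply hu; lra]).
apply hT1 in hE; lra.
Qed.

(** * The Schwarz-Pick inequality *)

(** Without a maximum, the values of [|F|] near each point are exceeded by one fixed value taken on
    the rectangle. [rectangle_induction] then yields a single [Cmod (F q)] exceeding all values, its
    own included. *)
Lemma Cmod_max_rectangle (F : C -> C) (a b c d : R) : a <= b -> c <= d ->
  (forall z, a <= Re z <= b -> c <= Im z <= d -> ccontinuous F z) ->
  exists q, (a <= Re q <= b /\ c <= Im q <= d) /\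
    forall z, a <= Re z <= b -> c <= Im z <= d -> Cmod (F z) <= Cmod (F q).
Proof.
intros hab hcd hc; apply NNPP; intros hno.
assert (hbig : forall q, a <= Re q <= b -> c <= Im q <= d ->
  exists z, (a <= Re z <= b /\ c <= Im z <= d) /\ Cmod (F q) < Cmod (F z)).
{ intros q h1 h2; apply NNPP; intros hn; apply hno; exists q; split; [tauto |].
  intros z h3 h4; apply Rnot_lt_le; intros h; apply hn; now exists z. }
set (P := fun a' b' c' d' => exists q, (a <= Re q <= b /\ c <= Im q <= d) /\
  forall x y, a' <= x <= b' -> c' <= y <= d' -> Cmod (F (x, y)) < Cmod (F q)).
assert (hP : P a b c d).
{ apply rectangle_induction; trivial.
  - intros a' b' c' d' _ _ [q1 [i1 h1]] [q2 [i2 h2]] [q3 [i3 h3]] [q4 [i4 h4]].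
    assert (hmax : forall q q', a <= Re q <= b /\ c <= Im q <= d -> a <= Re q' <= b /\ c <= Im q' <= d ->
      exists r, (a <= Re r <= b /\ c <= Im r <= d) /\ Cmod (F q) <= Cmod (F r) /\ Cmod (F q') <= Cmod (F r)).
    { intros q q' i i'; destruct (Rle_dec (Cmod (F q)) (Cmod (F q'))); [exists q' | exists q]; repeat split; tauto || lra. }
    destruct (hmax q1 q2 i1 i2) as [r1 [j1 k1]]; destruct (hmax q3 q4 i3 i4) as [r2 [j2 k2]].
    destruct (hmax r1 r2 j1 j2) as [r [j k]]; exists r; split; trivial; intros x y hx hy.
    destruct (Rle_dec x ((a' + b') / 2)); destruct (Rle_dec y ((c' + d') / 2)).
    + specialize (h1 x y ltac:(lra) ltac:(lra)); lra.
    + specialize (h3 x y ltac:(lra) ltac:(lra)); lra.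
    + specialize (h2 x y ltac:(lra) ltac:(lra)); lra.
    + specialize (h4 x y ltac:(lra) ltac:(lra)); lra.
  - intros x y hx hy; destruct (hbig (x, y) hx hy) as [q [hq hlt]].
    destruct (proj1 (ccontinuous_eps F (x, y)) (hc (x, y) hx hy) _ (proj2 (Rlt_0_minus _ _) hlt))
      as [delta [hd1 hd2]].
    exists (delta / 2); split; [lra |].
    intros a' b' c' d' h1 h2 h3 h4 h5 h6; exists q; split; trivial; intros u v hu hv.
    assert (hn := hd2 (u, v)).
    assert (hm : Cmod ((u, v) - (x, y)) < delta).
    { eapply Rle_lt_trans; [apply Cmod_le_Rmax |]; simpl.
      assert (Rmax (Rabs (u + - x)) (Rabs (v + - y)) < delta / 2)
        by (apply Rmax_lub_lt; apply Rabs_lt_between; lra); lra. }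
    specialize (hn hm).
    pose proof (Cmod_triangle (F (u, v) - F (x, y)) (F (x, y))) as ht.
    replace (F (u, v) - F (x, y) + F (x, y))%C with (F (u, v)) in ht by ring; lra. }
destruct hP as [q [hq h]]; specialize (h (Re q) (Im q) (proj1 hq) (proj2 hq)).
replace (Re q, Im q) with q in h by (now destruct q); lra.
Qed.

Lemma Cmod2_minus_conj (z w : C) : Cmod (z - Cconj w) ^ 2 = Cmod (z - w) ^ 2 + 4 * Im z * Im w.
Proof. rewrite !Cmod2_alt; unfold Re, Im; simpl; ring. Qed.

Lemma minus_conj_neq_0 (z w : C) : upper_half_plane z -> upper_half_plane w -> (z - Cconj w)%C <> 0.
Proof. unfold upper_half_plane, Im; intros hz hw e; apply (f_equal snd) in e; simpl in e; lra. Qed.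

Lemma Cminus_neq_0 (z w : C) : z <> w -> (z - w)%C <> 0.
Proof. intros h e; apply h; replace z with (z - w + w)%C by ring; rewrite e; ring. Qed.

Lemma ex_cderive_ext_near (f g : C -> C) (z : C) (delta : R) : 0 < delta ->
  (forall w, Cmod (w - z) < delta -> f w = g w) -> ex_cderive f z -> ex_cderive g z.
Proof.
intros hdelta hfg [l hf]; exists l; apply is_cderive_eps; intros eps heps.
destruct (proj1 (is_cderive_eps f z l) hf eps heps) as [d1 [p1 h1]].
exists (Rmin d1 delta); split; [now apply Rmin_glb_lt |]; intros w hw.
rewrite <- !hfg.
- apply h1; eapply Rlt_le_trans; [apply hw | apply Rmin_l].
- replace (z - z)%C with (RtoC 0) by ring; now rewrite Cmod_0.
- eapply Rlt_le_trans; [apply hw | apply Rmin_r].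
Qed.

(** The divided difference of [g]; when [l] is the derivative at [z0], its removable singularity is
    filled continuously. *)
Definition slope (g : C -> C) (z0 l z : C) : C :=
  if Ceq_dec z z0 then l else ((g z - g z0) / (z - z0))%C.

Lemma slope_continuous (g : C -> C) (z0 l : C) : is_cderive g z0 l -> ccontinuous (slope g z0 l) z0.
Proof.
intros h; apply ccontinuous_eps; intros eps heps.
destruct (proj1 (is_cderive_eps g z0 l) h (eps / 2)) as [delta [h1 h2]]; [lra |].
exists delta; split; trivial; intros w hw; unfold slope.
destruct (Ceq_dec z0 z0) as [_ | n]; [| now elim n].
destruct (Ceq_dec w z0) as [e | n].
- replace (l - l)%C with (RtoC 0) by ring; now rewrite Cmod_0.
- apply Cminus_neq_0 in n.
  replace ((g w - g z0) / (w - z0) - l)%C with ((g w - g z0 - (w - z0) * l) / (w - z0))%C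
    by (field; exact n).
  rewrite Cmod_div by exact n; apply Rle_lt_trans with (eps / 2); [| lra].
  apply Rle_div_l; [now apply Cmod_gt_0 | now apply h2].
Qed.

Lemma slope_derivable (g : C -> C) (z0 l z : C) : z <> z0 -> ex_cderive g z ->
  ex_cderive (slope g z0 l) z.
Proof.
intros hz hg; assert (hn := Cminus_neq_0 _ _ hz).
apply (ex_cderive_ext_near (fun w => (g w - g z0) * / (w - z0))%C _ z (Cmod (z - z0))).
- now apply Cmod_gt_0.
- intros w hw; unfold slope; destruct (Ceq_dec w z0) as [-> |]; [| reflexivity].
  rewrite Cmod_minus_sym in hw; lra.
- apply ex_cderive_mult.
  + apply ex_cderive_minus; [exact hg | apply ex_cderive_const].
  + apply ex_cderive_inv; [exact hn |].
    apply ex_cderive_minus; [apply ex_cderive_id | apply ex_cderive_const].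
Qed.

(* The quotient [Phi] of the two sides has modulus less than
   [|z - conj z0| / |z - z0|], which tends to 1 at the boundary of the half-plane.
   So if [|Phi|] exceeded 1, it would attain its maximum, and keep this value
   along a vertical ray, where that bound excludes it. *)
Lemma schwarz_pick (g : C -> C) (z0 z : C) :
  holomorphic_on upper_half_plane g ->
  (forall z, upper_half_plane z -> upper_half_plane (g z)) ->
  upper_half_plane z0 -> upper_half_plane z ->
  Cmod (g z - g z0) * Cmod (z - Cconj z0) <= Cmod (g z - Cconj (g z0)) * Cmod (z - z0).
Proof.
intros hol hmap hz0 hz.
destruct (hol z0 hz0) as [l hl].
set (w0 := g z0) in *.
assert (hw0 : upper_half_plane w0) by now apply hmap.
set (N := fun z => ((z - Cconj z0) * / (g z - Cconj w0))%C).
(* Off [z0] this is the quotient of [(g z - w0) / (g z - conj w0)] by [(z - z0) / (z - conj z0)]. *)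
set (Phi := fun z => (slope g z0 l z * N z)%C).
assert (hN : forall z, upper_half_plane z -> ex_cderive N z).
{ intros x hx; apply ex_cderive_mult.
  - apply ex_cderive_minus; [apply ex_cderive_id | apply ex_cderive_const].
  - apply (ex_cderive_inv (fun z => g z - Cconj w0)%C).
    + apply minus_conj_neq_0; auto.
    + apply ex_cderive_minus; [now apply hol | apply ex_cderive_const]. }
assert (hder : forall z, upper_half_plane z -> z <> z0 -> ex_cderive Phi z).
{ intros x hx hn; apply ex_cderive_mult; [| now apply hN].
  apply slope_derivable; auto. }
assert (hcont : forall z, upper_half_plane z -> ccontinuous Phi z).
{ intros x hx; destruct (Ceq_dec x z0) as [-> | n].
  - apply ccontinuous_mult; [now apply slope_continuous | apply ex_cderive_continuous; now apply hN].
  - apply ex_cderive_continuous; auto. }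
assert (heq : forall z, upper_half_plane z -> z <> z0 ->
  Cmod (Phi z) * (Cmod (g z - Cconj w0) * Cmod (z - z0)) = Cmod (g z - w0) * Cmod (z - Cconj z0)).
{ intros x hx hn; unfold Phi, N, slope; destruct (Ceq_dec x z0) as [e |]; [easy |].
  apply Cminus_neq_0 in hn; assert (hd := minus_conj_neq_0 (g x) w0 (hmap x hx) hw0).
  rewrite <- !Cmod_mult; f_equal; fold w0; field; auto. }
(* By [Cmod2_minus_conj], [|g z - w0| < |g z - conj w0|], hence
   [|Phi z| |z - z0| < |z - conj z0|]. *)
assert (hbound : forall z, upper_half_plane z -> z <> z0 ->
  Cmod (Phi z) ^ 2 * Cmod (z - z0) ^ 2 < Cmod (z - z0) ^ 2 + 4 * Im z * Im z0).
{ intros x hx hn; rewrite <- Cmod2_minus_conj.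
  assert (h := heq x hx hn).
  assert (hg := Cmod2_minus_conj (g x) w0); assert (hgx := hmap x hx); unfold upper_half_plane in *.
  assert (hp : 0 < Im (g x) * Im w0) by now apply Rmult_lt_0_compat.
  assert (hd := proj1 (Cmod_gt_0 _) (minus_conj_neq_0 x z0 hx hz0)).
  assert (ha := proj1 (Cmod_gt_0 _) (minus_conj_neq_0 (g x) w0 hgx hw0)).
  apply (f_equal (fun t => t ^ 2)) in h; rewrite !Rpow_mult_distr in h.
  set (A := Cmod (g x - Cconj w0) ^ 2) in *; set (B := Cmod (g x - w0) ^ 2) in *.
  set (U := Cmod (x - Cconj z0) ^ 2) in *; set (S := Cmod (Phi x) ^ 2 * Cmod (x - z0) ^ 2) in *.
  assert (0 < U) by (unfold U; apply pow_lt; exact hd).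
  assert (0 < A) by (unfold A; apply pow_lt; exact ha).
  assert (h' : A * S = B * U) by (unfold S; lra).
  nra. }
assert (hle : Cmod (Phi z) <= 1).
{ apply Rnot_lt_le; intros hgt.
  set (kappa := Cmod (Phi z) ^ 2 - 1).
  assert (hk : 0 < kappa) by (unfold kappa; nra).
  unfold upper_half_plane in *.
  set (y0 := Im z0) in *; set (x0 := Re z0).
  (* Points [w] other than [z0] where [|Phi|] is at least [|Phi z|] satisfy
     [kappa |w - z0|^2 < 4 y0 Im w]. Below height [y0 / 2] one has [|w - z0| >= y0 / 2], which gives
     [e]; above [2 y0] one has [|w - z0| >= Im w / 2], which gives [Y]; then [X] bounds the width,
     using [X <= X^2]. *)
  set (Y := 2 * y0 + 16 * y0 / kappa); set (X := 1 + 4 * Y * y0 / kappa).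
  set (e := Rmin (y0 / 2) (kappa * y0 / 16)).
  assert (hY0 : 0 < 16 * y0 / kappa) by (apply Rdiv_lt_0_compat; lra).
  assert (hY1 : 2 * y0 < Y) by (unfold Y; lra).
  assert (hY2 : 16 * y0 < kappa * Y).
  { unfold Y; replace (kappa * (2 * y0 + 16 * y0 / kappa)) with (2 * kappa * y0 + 16 * y0) by (field; lra); nra. }
  assert (hX1 : 4 * Y * y0 < kappa * X).
  { unfold X; replace (kappa * (1 + 4 * Y * y0 / kappa)) with (kappa + 4 * Y * y0) by (field; lra); lra. }
  assert (hX2 : 1 < X).
  { unfold X; assert (0 < 4 * Y * y0 / kappa) by (apply Rdiv_lt_0_compat; nra); lra. }
  assert (he0 : 0 < e) by (apply Rmin_glb_lt; nra).
  assert (he1 : e <= y0 / 2) by apply Rmin_l; assert (he2 : e <= kappa * y0 / 16) by apply Rmin_r.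
  assert (hin : forall w, 0 < Im w -> Cmod (Phi z) <= Cmod (Phi w) ->
    x0 - X <= Re w <= x0 + X /\ e <= Im w <= Y).
  { intros w hw hwz; destruct (Ceq_dec w z0) as [-> | n]; [fold x0 y0; lra |].
    assert (hb := hbound w hw n).
    assert (h2 : Cmod (Phi z) ^ 2 <= Cmod (Phi w) ^ 2) by (apply pow_incr; lra).
    assert (hd : Cmod (w - z0) ^ 2 = (Re w - x0) ^ 2 + (Im w - y0) ^ 2).
    { rewrite Cmod2_alt; unfold x0, y0, Re, Im; simpl; ring. }
    assert (hkd : kappa * ((Re w - x0) ^ 2 + (Im w - y0) ^ 2) < 4 * Im w * y0).
    { rewrite <- hd; unfold kappa; pose proof (pow2_ge_0 (Cmod (w - z0))); nra. }
    set (x := Re w) in *; set (y := Im w) in *.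
    assert (hy : e <= y <= Y).
    { split; apply Rnot_lt_le; intros hc.
      - assert (y0 ^ 2 / 4 <= (x - x0) ^ 2 + (y - y0) ^ 2).
        { assert (0 <= (y0 / 2 - y) * (3 / 2 * y0 - y)) by (apply Rmult_le_pos; lra).
          pose proof (pow2_ge_0 (x - x0)); lra. }
        assert (kappa * (y0 ^ 2 / 4) <= kappa * ((x - x0) ^ 2 + (y - y0) ^ 2))
          by (apply Rmult_le_compat_l; lra).
        assert (y0 * (kappa * y0) < y0 * (16 * y)) as hc2 by lra.
        apply Rmult_lt_reg_l in hc2; lra.
      - assert (y ^ 2 / 4 <= (x - x0) ^ 2 + (y - y0) ^ 2).
        { assert (0 <= (y / 2 - y0) * (3 / 2 * y - y0)) by (apply Rmult_le_pos; lra).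
          pose proof (pow2_ge_0 (x - x0)); lra. }
        assert (kappa * (y ^ 2 / 4) <= kappa * ((x - x0) ^ 2 + (y - y0) ^ 2))
          by (apply Rmult_le_compat_l; lra).
        assert (y * (kappa * y) < y * (16 * y0)) as hc2 by lra.
        apply Rmult_lt_reg_l in hc2; [| exact hw].
        assert (kappa * Y < kappa * y) by (apply Rmult_lt_compat_l; lra); lra. }
    split; trivial.
    assert (hx : kappa * (x - x0) ^ 2 < kappa * X ^ 2).
    { assert (0 <= kappa * (y - y0) ^ 2) by (apply Rmult_le_pos; [lra | apply pow2_ge_0]).
      assert (y * y0 <= Y * y0) by (apply Rmult_le_compat_r; lra).
      assert (kappa * X <= kappa * X ^ 2) by (apply Rmult_le_compat_l; nra); lra. }
    apply Rmult_lt_reg_l in hx; trivial.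
    assert (Rabs (x - x0) < Rabs X) as hab by (apply Rsqr_lt_abs_0; unfold Rsqr; lra).
    rewrite (Rabs_pos_eq X) in hab by lra; apply Rabs_lt_between in hab; lra. }
  destruct (Cmod_max_rectangle Phi (x0 - X) (x0 + X) e Y) as [q [hq hqmax]]; try lra.
  { intros w _ hw; apply hcont; lra. }
  assert (hzin := hin z hz (Rle_refl _)).
  assert (hqz := hqmax z (proj1 hzin) (proj2 hzin)).
  assert (hray := maximum_principle_ray Phi q ltac:(unfold upper_half_plane; lra) hcont).
  assert (e1 : Phi (Re q, Im q + Y) = Phi q).
  { apply hray; [| | lra].
    - intros w hw; unfold upper_half_plane in hw.
      (* A punctured disc around [w] avoids [z0], whether or not [w] is [z0]. *)
      assert (hr : exists r, 0 < r /\ forall v, 0 < Cmod (v - w) < r -> v <> z0).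
      { destruct (Ceq_dec w z0) as [-> | n].
        - exists 1; split; [lra |]; intros v hv ->.
          replace (z0 - z0)%C with (RtoC 0) in hv by ring; rewrite Cmod_0 in hv; lra.
        - exists (Cmod (w - z0)); split; [now apply Cmod_gt_0, Cminus_neq_0 |].
          intros v hv ->; rewrite Cmod_minus_sym in hv; lra. }
      destruct hr as [r [hr1 hr2]].
      exists (Rmin r (Im w)); split; [now apply Rmin_glb_lt |]; intros v hv.
      assert (v1 : Cmod (v - w) < r) by (eapply Rlt_le_trans; [apply hv | apply Rmin_l]).
      assert (v2 : Cmod (v - w) < Im w) by (eapply Rlt_le_trans; [apply hv | apply Rmin_r]).
      apply hder; [| apply hr2; lra].
      assert (h3 := Rle_lt_trans _ _ _ (proj2 (Cmod_Re_Im_le (v - w))) v2).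
      apply Rabs_lt_between in h3; unfold upper_half_plane, Im in *; simpl in h3; lra.
    (* Outside the rectangle [|Phi w| < |Phi z|], so the maximum over the rectangle is global. *)
    - intros w hw; destruct (Rle_dec (Cmod (Phi z)) (Cmod (Phi w))) as [h | h]; [| lra].
      destruct (hin w hw h); now apply hqmax. }
  (* [|Phi|] keeps its maximal value at a height above [Y], which [hin] forbids. *)
  destruct (hin (Re q, Im q + Y)) as [_ h].
  - simpl; unfold Im in *; lra.
  - rewrite e1; exact hqz.
  - simpl in h; unfold Im in *; lra. }
destruct (Ceq_dec z z0) as [-> | n].
- fold w0; replace (w0 - w0)%C with (RtoC 0) by ring; rewrite Cmod_0, Rmult_0_l.
  apply Rmult_le_pos; apply Cmod_ge_0.
- rewrite <- heq by trivial.
  rewrite <- (Rmult_1_l (Cmod (g z - Cconj w0) * _)) at 2.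
  apply Rmult_le_compat_r; trivial; apply Rmult_le_pos; apply Cmod_ge_0.
Qed.

(** * Hydrodynamic normalization *)

Lemma sector_quarter (x y : R) : Rabs x < y -> sector (PI / 4) (x, y).
Proof.
intros hxy; pose proof (Rabs_pos x); pose proof PI_RGT_0 as hpi.
assert (hz : (x, y) <> RtoC 0) by (intros e; apply (f_equal snd) in e; simpl in e; lra).
split; trivial.
destruct (Carg_spec _ hz) as [hA e].
set (A := Carg (x, y)) in *; set (m := Cmod (x, y)) in *.
assert (hm : 0 < m) by now apply Cmod_gt_0.
injection e as ex ey.
assert (hsin : 0 < sin A) by (apply Rmult_lt_reg_l with m; lra).
assert (hA0 : 0 < A).
{ apply Rnot_le_lt; intros h; assert (0 <= sin (- A)) by (apply sin_ge_0; lra).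
  rewrite sin_neg in *; lra. }
assert (hApi : A < PI).
{ destruct (proj2 hA) as [h | h]; trivial; rewrite h, sin_PI in hsin; lra. }
assert (hcos : Rabs (cos A) < sin A).
{ rewrite ex, ey in hxy; rewrite Rabs_mult, Rabs_pos_eq in hxy by lra.
  now apply Rmult_lt_reg_l with m. }
apply Rabs_lt_between in hcos.
(* Up to the factor [sqrt 2], the two sines are [sin A - cos A] and [sin A + cos A]. Their
   positivity excludes [A <= PI / 4] and [A >= 3 PI / 4] respectively. *)
assert (s1 : 0 < sin (A - PI / 4) * sqrt 2).
{ rewrite sin_minus, cos_PI4, sin_PI4.
  replace ((sin A * (1 / sqrt 2) - cos A * (1 / sqrt 2)) * sqrt 2) with (sin A - cos A); [lra |].
  field; apply Rgt_not_eq, sqrt_lt_R0; lra. }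
assert (s2 : 0 < sin (A + PI / 4) * sqrt 2).
{ rewrite sin_plus, cos_PI4, sin_PI4.
  replace ((sin A * (1 / sqrt 2) + cos A * (1 / sqrt 2)) * sqrt 2) with (sin A + cos A); [lra |].
  field; apply Rgt_not_eq, sqrt_lt_R0; lra. }
assert (hs : 0 < sqrt 2) by (apply sqrt_lt_R0; lra).
apply Rabs_lt_between; split; apply Rnot_le_lt; intros h.
- assert (0 <= sin (- (A - PI / 4))) by (apply sin_ge_0; lra).
  rewrite sin_neg in *; nra.
- assert (0 <= sin (A + PI / 4 - PI)) by (apply sin_ge_0; lra).
  rewrite sin_minus, cos_PI, sin_PI in *; nra.
Qed.

(** Every vertical line eventually enters the sector of half-angle [PI / 4]. The bounds on [g z0]
    use the normalization in this form. *)
Lemma hydrodynamic_vertical (g : C -> C) (x eta : R) : hydrodynamic_normalization g -> 0 < eta ->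
  exists T, forall y, T < y -> Cmod (g (x, y) - (x, y)) < eta.
Proof.
intros hg heta; pose proof PI_RGT_0.
destruct (hg (PI / 4) ltac:(lra) (fun w => Cmod w < eta)) as [M hM].
(* The balls of [C_UniformSpace] are squares, so half of [eta] is allowed in each coordinate. *)
{ assert (h : 0 < eta / 2) by lra; exists (mkposreal _ h); intros w [h1 h2].
  eapply Rle_lt_trans; [apply Cmod_le_Rmax |].
  assert (Rmax (Rabs (Re w)) (Rabs (Im w)) < eta / 2); [| lra].
  change (Rabs (Re w - 0) < eta / 2) in h1; change (Rabs (Im w - 0) < eta / 2) in h2.
  rewrite Rminus_0_r in h1, h2; now apply Rmax_lub_lt. }
exists (Rmax M (Rabs x)); intros y hy.
pose proof (Rmax_l M (Rabs x)); pose proof (Rmax_r M (Rabs x)).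
apply hM.
- pose proof (proj2 (Cmod_Re_Im_le (x, y))) as h; simpl in h; pose proof (Rle_abs y); lra.
- apply sector_quarter; lra.
Qed.

Lemma Im_le_of_hydrodynamic (g : C -> C) (z0 : C) : H_infty g -> upper_half_plane z0 ->
  Im z0 <= Im (g z0).
Proof.
intros [hol [hmap hyd]] hz0; apply Rnot_lt_le; intros hlt.
assert (hb := hmap z0 hz0); unfold upper_half_plane in hb, hz0.
set (y0 := Im z0) in *; set (b := Im (g z0)) in *.
(* The tolerance [y0 - b] makes [Im (g z) - b] exceed [t], so that [|g z - g z0| >= |z - z0|]. *)
destruct (hydrodynamic_vertical g (Re z0) (y0 - b) hyd ltac:(lra)) as [T hT].
set (t := Rmax (Rmax T 1) (y0 * y0 / (y0 - b)) + 1).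
assert (ht1 : T < t /\ 1 < t /\ y0 * y0 / (y0 - b) < t).
{ pose proof (Rmax_l (Rmax T 1) (y0 * y0 / (y0 - b))); pose proof (Rmax_r (Rmax T 1) (y0 * y0 / (y0 - b))).
  pose proof (Rmax_l T 1); pose proof (Rmax_r T 1); unfold t; lra. }
destruct ht1 as [ht1 [ht2 ht3]].
apply Rlt_div_l in ht3; [| lra].
set (z := (Re z0, y0 + t)).
assert (hz : upper_half_plane z) by (unfold upper_half_plane, z; simpl; lra).
specialize (hT (y0 + t) ltac:(lra)); fold z in hT.
assert (hG := Rle_lt_trans _ _ _ (proj2 (Cmod_Re_Im_le (g z - z))) hT).
apply Rabs_lt_between in hG.
assert (eG : Im (g z - z) = Im (g z) - (y0 + t)) by (unfold z, Im; simpl; ring).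
rewrite eG in hG; clear eG.
assert (hsp := schwarz_pick g z0 z hol hmap hz0 hz).
assert (hsp2 : (Cmod (g z - g z0) * Cmod (z - Cconj z0)) ^ 2 <= (Cmod (g z - Cconj (g z0)) * Cmod (z - z0)) ^ 2).
{ apply pow_incr; split; trivial; apply Rmult_le_pos; apply Cmod_ge_0. }
(* With [e] and [G] as named below, the squared inequality reduces to [e (y0 + t) y0 <= t^2 G b];
   since [e >= t^2] and [G < y0 + t + (y0 - b)], this contradicts [b < y0]. *)
rewrite !Rpow_mult_distr, !Cmod2_minus_conj in hsp2.
assert (hd : Cmod (z - z0) ^ 2 = t ^ 2).
{ rewrite Cmod2_alt; unfold z, y0, Re, Im; simpl; ring. }
assert (he : (Im (g z) - b) ^ 2 <= Cmod (g z - g z0) ^ 2).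
{ rewrite Cmod2_alt; replace (Im (g z - g z0)) with (Im (g z) - b) by (unfold b, Im; simpl; ring).
  pose proof (pow2_ge_0 (Re (g z - g z0))); lra. }
rewrite hd in hsp2; replace (Im z) with (y0 + t) in hsp2 by reflexivity.
fold y0 b in hsp2.
set (G := Im (g z)) in *; set (e := Cmod (g z - g z0) ^ 2) in *.
assert (he2 : t ^ 2 <= e) by nra.
assert (ht : 0 < t ^ 2) by nra.
assert (h1 : e * ((y0 + t) * y0) <= t ^ 2 * (G * b)) by lra.
assert (h2 : t ^ 2 * ((y0 + t) * y0) <= t ^ 2 * (G * b)).
{ eapply Rle_trans; [| apply h1]; apply Rmult_le_compat_r; nra. }
apply Rmult_le_reg_l in h2; trivial.
assert (G * b <= (y0 + t + (y0 - b)) * b) by (apply Rmult_le_compat_r; lra).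
nra.
Qed.

Lemma fixed_of_Im_eq (g : C -> C) (z0 : C) : H_infty g -> upper_half_plane z0 ->
  Im (g z0) = Im z0 -> g z0 = z0.
Proof.
intros hg hz0 heq; assert (hg' := hg); destruct hg' as [hol [hmap hyd]].
set (a := Re (g z0 - z0)).
assert (ha : (g z0 - z0)%C = RtoC a).
{ apply injective_projections; [reflexivity |]; unfold Im in heq; simpl; lra. }
(* The shift by [i] gives [Im q >= 1], by the preceding lemma, and [q z0 = i]; so [/ q] is
   holomorphic on the half-plane and has maximal modulus at [z0]. *)
set (q := fun z => (g z - z - (RtoC a - Ci))%C).
assert (hq : forall z, upper_half_plane z -> 1 <= Im (q z)).
{ intros z hz; assert (h := Im_le_of_hydrodynamic g z hg hz).
  unfold q, Im in *; simpl; lra. }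
assert (hq1 : forall z, upper_half_plane z -> 1 <= Cmod (q z)).
{ intros z hz; specialize (hq z hz); pose proof (proj2 (Cmod_Re_Im_le (q z)));
  pose proof (Rle_abs (Im (q z))); lra. }
assert (hq0 : forall z, upper_half_plane z -> q z <> 0).
{ intros z hz; apply Cmod_gt_0; specialize (hq1 z hz); lra. }
assert (hqz0 : q z0 = Ci) by (unfold q; rewrite ha; ring).
assert (hder : forall z, upper_half_plane z -> ex_cderive (fun z => / q z)%C z).
{ intros z hz; apply (ex_cderive_inv q); auto.
  apply ex_cderive_minus; [| apply ex_cderive_const].
  apply ex_cderive_minus; [now apply hol | apply ex_cderive_id]. }
assert (hray := maximum_principle_ray (fun z => / q z)%C z0 hz0
  (fun z hz => ex_cderive_continuous _ _ (hder z hz))).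
(* On the ray above [z0] the difference [g z - z] is constantly [a], while the normalization makes
   it arbitrarily small far up. *)
assert (ha0 : Cmod a <= 0).
{ apply le_epsilon; intros eps heps; rewrite Rplus_0_l.
  destruct (hydrodynamic_vertical g (Re z0) eps hyd heps) as [T hT].
  set (t := Rmax 0 (T - Im z0) + 1).
  pose proof (Rmax_l 0 (T - Im z0)); pose proof (Rmax_r 0 (T - Im z0)).
  specialize (hT (Im z0 + t) ltac:(unfold t; lra)).
  set (z := (Re z0, Im z0 + t)) in *.
  assert (hz : upper_half_plane z) by (unfold upper_half_plane, z, t in *; simpl; lra).
  assert (e : (/ q z = / q z0)%C).
  { apply hray; [| | unfold t; lra].
    - intros w hw; exists (Im w); split; trivial; intros v hv; apply hder.
      assert (h3 := Rle_lt_trans _ _ _ (proj2 (Cmod_Re_Im_le (v - w))) (proj2 hv)).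
      apply Rabs_lt_between in h3; unfold upper_half_plane, Im in *; simpl in h3; lra.
    - intros w hw; rewrite hqz0, !Cmod_inv, Cmod_Ci, Rinv_1 by (auto; now rewrite <- hqz0; auto).
      rewrite <- Rinv_1; apply Rinv_le_contravar; [lra | auto]. }
  assert (e2 : q z = Ci).
  { rewrite <- hqz0; rewrite <- (Cmult_1_r (q z)), <- (Cinv_l (q z0)), <- e by auto.
    rewrite Cmult_assoc; field; auto. }
  replace (RtoC a) with (g z - z)%C; [lra |].
  unfold q in e2; replace (g z - z)%C with (g z - z - (RtoC a - Ci) + (RtoC a - Ci))%C by ring.
  rewrite e2; ring. }
assert (e : RtoC a = RtoC 0) by (apply Cmod_eq_0, Rle_antisym; [exact ha0 | apply Cmod_ge_0]).
replace (g z0) with (g z0 - z0 + z0)%C by ring; rewrite ha, e; ring.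
Qed.

(** * Univalent maps with a prescribed value *)

Lemma hydrodynamic_of_bound (g : C -> C) :
  (forall eps, 0 < eps -> exists M, forall z, M < Cmod z -> Cmod (g z - z) < eps) ->
  hydrodynamic_normalization g.
Proof.
intros h beta _ P [eps hP]; destruct (h eps (cond_pos eps)) as [M hM].
exists M; intros z hz _; apply hP, C_NormedModule_mixin_compat1.
change (Cmod (g z - z - 0) < eps).
replace (g z - z - 0)%C with (g z - z)%C by ring; now apply hM.
Qed.

Definition pole_map (c : R) (a z : C) : C := (z - RtoC c * / (z - a))%C.

(** As [a] lies below the real axis, [- c / (z - a)] has positive imaginary part on the half-plane;
    it tends to 0 at infinity in every direction. *)
Lemma pole_map_H_infty (c : R) (a : C) : 0 < c -> Im a < 0 -> H_infty (pole_map c a).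
Proof.
intros hc ha.
assert (hn : forall z, upper_half_plane z -> (z - a)%C <> 0).
{ unfold upper_half_plane, Im in *; intros z hz e; apply (f_equal snd) in e; simpl in e; lra. }
split; [| split].
- intros z hz; apply ex_cderive_minus; [apply ex_cderive_id |].
  apply ex_cderive_mult; [apply ex_cderive_const |].
  apply (ex_cderive_inv (fun w => w - a)%C); [now apply hn |].
  apply ex_cderive_minus; [apply ex_cderive_id | apply ex_cderive_const].
- intros z hz; assert (h := hn z hz); unfold upper_half_plane in *.
  assert (hm := pow_lt _ 2 (proj1 (Cmod_gt_0 _) h)); rewrite Cmod2_alt in hm.
  assert (e : Im (pole_map c a z) =
    Im z + c * (Im (z - a) / (Re (z - a) ^ 2 + Im (z - a) ^ 2))).
  { unfold pole_map, Im, Re in *; simpl in *; field; lra. }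
  rewrite e; assert (0 < c * (Im (z - a) / (Re (z - a) ^ 2 + Im (z - a) ^ 2))); [| lra].
  apply Rmult_lt_0_compat; trivial; apply Rdiv_lt_0_compat; trivial.
  unfold Im in *; simpl; lra.
- apply hydrodynamic_of_bound; intros eps heps; exists (Cmod a + c / eps); intros z hz.
  assert (h1 : c / eps < Cmod (z - a)).
  { pose proof (Cmod_triangle (z - a) a) as h; replace (z - a + a)%C with z in h by ring; lra. }
  assert (h0 : 0 < c / eps) by (apply Rdiv_lt_0_compat; lra).
  assert (h2 : (z - a)%C <> 0) by (apply Cmod_gt_0; lra).
  replace (pole_map c a z - z)%C with (- (RtoC c / (z - a)))%C by (unfold pole_map; field; exact h2).
  rewrite Cmod_opp, Cmod_div, Cmod_R, Rabs_pos_eq by (trivial; lra).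
  apply Rlt_div_l; [lra |]; apply Rlt_div_l in h1; [lra | exact heps].
Qed.

(** The images differ by [(z - w) (1 + c / ((z - a) (w - a)))]. Both [z - a] and [w - a] have
    modulus above [- Im a], so the second factor cannot vanish. *)
Lemma pole_map_injective (c : R) (a : C) : Im a < 0 -> c <= Im a ^ 2 -> 0 < c ->
  injective_on upper_half_plane (pole_map c a).
Proof.
intros ha hca hc z w hz hw e; unfold upper_half_plane in *.
assert (him : forall z, 0 < Im z -> - Im a < Cmod (z - a)).
{ intros x hx; pose proof (proj2 (Cmod_Re_Im_le (x - a))) as h; pose proof (Rle_abs (Im (x - a))).
  unfold Im in *; simpl in *; lra. }
assert (h1 := him z hz); assert (h2 := him w hw).
assert (n1 : (z - a)%C <> 0) by (apply Cmod_gt_0; lra).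
assert (n2 : (w - a)%C <> 0) by (apply Cmod_gt_0; lra).
assert (hprod : ((z - w) * ((z - a) * (w - a) + RtoC c) = 0)%C).
{ transitivity ((pole_map c a z - pole_map c a w) * ((z - a) * (w - a)))%C.
  - unfold pole_map; field; auto.
  - rewrite e; ring. }
destruct (Ceq_dec z w) as [| hne]; trivial; exfalso.
apply (Cmult_neq_0 _ _ (Cminus_neq_0 _ _ hne)) in hprod; trivial.
intros e2; assert (e3 : ((z - a) * (w - a) = - RtoC c)%C).
{ replace ((z - a) * (w - a))%C with ((z - a) * (w - a) + RtoC c - RtoC c)%C by ring; rewrite e2; ring. }
apply (f_equal Cmod) in e3; rewrite Cmod_mult, Cmod_opp, Cmod_R, Rabs_pos_eq in e3 by lra; nra.
Qed.

Theorem theorem2p2 (z0 : C) (hz0 : upper_half_plane z0) :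
  forall w : C,
    (exists g : C -> C,
       H_infty g /\ univalent_on upper_half_plane g /\ g z0 = w)
    <-> ((Im w > Im z0)%R \/ w = z0).
Proof.
intros w; split.
- intros [g [hg [_ <-]]].
  destruct (Im_le_of_hydrodynamic g z0 hg hz0) as [h | h]; [now left | right].
  now apply fixed_of_Im_eq.
- intros [hw | ->].
  + set (zeta := (w - z0)%C).
    assert (hzeta : 0 < Im zeta) by (unfold zeta, Im in *; simpl; lra).
    assert (hn : zeta <> 0) by (intros e; rewrite e in hzeta; simpl in hzeta; lra).
    assert (hm := pow_lt _ 2 (proj1 (Cmod_gt_0 _) hn)).
    unfold upper_half_plane in hz0.
    (* [k] is [- Im (1 / zeta)], so that [Im a = Im z0 - c k] for the pole [a] below. *)
    set (k := Im zeta / Cmod zeta ^ 2); assert (hk : 0 < k) by now apply Rdiv_lt_0_compat.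
    set (u := 1 + Im z0 * k); assert (hu : 1 < u) by (unfold u; nra).
    (* With this choice [- Im a = (u^2 - u + 1) / k], which is at least [u / k], the square root of
       [c], because [(u - 1)^2 >= 0]. *)
    set (c := u ^ 2 / k ^ 2).
    assert (hc : 0 < c) by (apply Rdiv_lt_0_compat; apply pow_lt; lra).
    set (a := (z0 + RtoC c / zeta)%C).
    assert (hck : Im a = - ((u ^ 2 - u + 1) / k)).
    { assert (e : Im a = Im z0 - c * k).
      { unfold a, k; rewrite Cmod2_alt in *; unfold Im, Re in *; simpl in *; field; lra. }
      rewrite e; unfold c; replace (Im z0) with ((u - 1) / k) by (unfold u; field; lra).
      field; lra. }
    assert (ha : Im a < 0).
    { rewrite hck; assert (0 < (u ^ 2 - u + 1) / k) by (apply Rdiv_lt_0_compat; nra); lra. }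
    assert (hca : c <= Im a ^ 2).
    { rewrite hck; replace ((- ((u ^ 2 - u + 1) / k)) ^ 2) with ((u ^ 2 - u + 1) ^ 2 / k ^ 2) by (field; lra).
      apply Rmult_le_compat_r; [apply Rlt_le, Rinv_0_lt_compat, pow_lt; lra |].
      apply pow_incr; nra. }
    assert (hg := pole_map_H_infty c a hc ha).
    exists (pole_map c a); split; [exact hg |]; split; [split |].
    * apply hg.
    * now apply pole_map_injective.
    * assert (hcC : RtoC c <> 0) by (intros e; apply (f_equal fst) in e; simpl in e; lra).
      unfold pole_map; replace (z0 - a)%C with (- (RtoC c / zeta))%C by (unfold a; ring).
      replace w with (z0 + zeta)%C by (unfold zeta; ring).
      field; auto.
  + exists (fun z => z); split; [| split; [split |]]; trivial.
    * split; [intros z _; apply ex_cderive_id | split; trivial].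
      apply hydrodynamic_of_bound; intros eps heps; exists 0; intros z _.
      replace (z - z)%C with (RtoC 0) by ring; now rewrite Cmod_0.
    * intros z _; apply ex_cderive_id.
    * intros z z' _ _ e; exact e.
Qed.
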